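(* Let $q\in(0,1)$ and $r=1-q$, and consider the random graph process $\mathcal{I}_{2V}$ with parameters $q,r$. For all integers $t\ge 0$ and $m\ge 0$, the probability $p_t(\mathbf{m}=m)$ that the graph has exactly $m$ edges at step $t$ is $$p_t(\mathbf{m}=m)=\begin{cases}1 & m=t+3,\\ 0 & m\neq t+3.\end{cases}$$
   Context: The probabilistic inductive class $\mathcal{I}_{2V}$ (2-vertex-connected graphs, multiple edges allowed, no loops) is the following random graph process. At step $0$ the graph is a triangle ($3$ vertices, $3$ edges). At each step one rule is chosen and applied, independently of the past: rule R2 with probability $q$, rule R3 with probability $r=1-q$. R2: choose two different vertices uniformly at random (possibly already adjacent) and add one edge joining them. R3: choose an edge uniformly at random and expand it with a vertex and another edge, i.e. subdivide it by one new vertex (adding one vertex and increasing the number of edges by one). $\mathbf{m}$ is the number of edges. *)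

(* Defs.v *)
From mathcomp Require Import all_boot all_order all_algebra.
From mathcomp Require Import all_classical all_reals all_analysis.

Set Implicit Arguments.
Unset Strict Implicit.
Unset Printing Implicit Defensive.

Import Order.TTheory GRing.Theory Num.Theory.
Local Open Scope classical_set_scope.
Local Open Scope ring_scope.

(* An unordered pair of distinct vertices, stored with increasing labels. *)
Definition edge (n : nat) := {e : 'I_n * 'I_n | (e.1 < e.2)%N}.

(* Loopless multigraphs with vertex set 'I_n.  Edges are listed individually,
   so parallel edges count, and are sampled, with multiplicity. *)
Definition mgraph := {n : nat & seq (edge n)}.

Definition nverts (G : mgraph) : nat := tag G.
Definition edges (G : mgraph) : seq (edge (nverts G)) := tagged G.
Definition nedges (G : mgraph) : nat := size (edges G).

Definition MGraph (n : nat) (s : seq (edge n)) : mgraph :=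
  Tagged (fun k => seq (edge k)) s.

Definition mk_edge (n : nat) (u v : 'I_n) (uv : (u < v)%N) : edge n :=
  exist (fun e : 'I_n * 'I_n => (e.1 < e.2)%N) (u, v) uv.

Definition triangle : mgraph :=
  MGraph [:: @mk_edge 3 (@Ordinal 3 0 isT) (@Ordinal 3 1 isT) isT;
             @mk_edge 3 (@Ordinal 3 0 isT) (@Ordinal 3 2 isT) isT;
             @mk_edge 3 (@Ordinal 3 1 isT) (@Ordinal 3 2 isT) isT].

Definition old_edge (n : nat) (e : edge n) : edge n.+1 :=
  @mk_edge n.+1 (widen_ord (leqnSn n) (val e).1)
    (widen_ord (leqnSn n) (val e).2) (valP e).

Definition new_edge (n : nat) (u : 'I_n) : edge n.+1 :=
  @mk_edge n.+1 (widen_ord (leqnSn n) u) ord_max (ltn_ord u).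

Definition add_edge (G : mgraph) (e : edge (nverts G)) : mgraph :=
  MGraph (e :: edges G).

(* With w the new vertex ord_max and uv the i-th edge, the i-th edge becomes
   uw and the edge vw is added. *)
Definition subdivide (G : mgraph) (i : 'I_(nedges G)) : mgraph :=
  let E := in_tuple (edges G) in
  MGraph (new_edge (val (tnth E i)).2 ::
    [seq (if j == i then new_edge (val (tnth E i)).1 else old_edge (tnth E j))
       | j <- enum 'I_(nedges G)]).

Inductive rule := R2 | R3.

Section Process.
Context {R : realType}.

(* Probability that f c = y when c is uniformly distributed on C. *)
Definition uniform_image (C : finType) (Y : eqType) (f : C -> Y) (y : Y) : R :=
  #|[set c | f c == y]%SET|%:R / #|C|%:R.

Definition rule_trans (a : rule) (G H : mgraph) : R :=
  match a with
  | R2 => uniform_image (@add_edge G) H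
  | R3 => uniform_image (@subdivide G) H
  end.

Definition rule_prob (q r : R) (a : rule) : R :=
  match a with R2 => q | R3 => r end.

Context {d : measure_display} {T : measurableType d}.

(* A s is the rule applied between step s and step s.+1. *)
Definition history (A : nat -> T -> rule) (G : nat -> T -> mgraph) (t : nat)
    (a : nat -> rule) (g : nat -> mgraph) : set T :=
  [set w | (forall s, (s <= t)%N -> G s w = g s) /\
           (forall s, (s < t)%N -> A s w = a s)].

(* The last field says that, given the whole past, rule a t is chosen with its
   fixed probability and is then applied to the current graph with fresh
   uniform randomness. *)
Record I2V_process (q r : R) (P : probability T R)
    (A : nat -> T -> rule) (G : nat -> T -> mgraph) : Prop := {
  I2V_measurable_rule : forall t a, measurable (A t @^-1` [set a]);
  I2V_measurable_graph : forall t g, measurable (G t @^-1` [set g]);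
  I2V_start : P (G 0%N @^-1` [set triangle]) = 1%E;
  I2V_step : forall t (a : nat -> rule) (g : nat -> mgraph),
    P (history A G t.+1 a g) =
      (P (history A G t a g) *
       (rule_prob q r (a t) * rule_trans (a t) (g t) (g t.+1))%:E)%E
}.

End Process.

(* Main.v *)
Require Import Defs.
From mathcomp Require Import all_boot all_order all_algebra.
From mathcomp Require Import all_classical all_reals all_analysis.

Import Order.TTheory GRing.Theory Num.Theory.
Local Open Scope classical_set_scope.
Local Open Scope ring_scope.

(** Both rules add exactly one edge, so a finite history ending in a step that
    does not has probability zero. There are countably many multigraphs, hence
    countably many such histories, and almost surely every step adds exactly
    one edge to the three edges of the triangle. *)

Lemma nedges_add_edge (G : mgraph) (e : edge (nverts G)) :
  nedges (add_edge e) = (nedges G).+1.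
Proof. by []. Qed.

Lemma nedges_subdivide (G : mgraph) (i : 'I_(nedges G)) :
  nedges (subdivide i) = (nedges G).+1.
Proof. by rewrite /nedges /= size_map size_enum_ord. Qed.

Lemma uniform_image_eq0 (R : realType) (C : finType) (Y : eqType) (f : C -> Y)
    (y : Y) :
  (forall c, f c <> y) -> uniform_image f y = 0 :> R.
Proof.
move=> fNy; rewrite /uniform_image; set S := finset _.
suff -> : S = finset.set0 by rewrite cards0 mul0r.
by apply/setP => c; rewrite !inE; apply/eqP/fNy.
Qed.

(** Every outcome of either rule has one edge more than [G], so no random choice produces [H]. *)
Lemma rule_trans_eq0 (R : realType) (a : rule) (G H : mgraph) :
  nedges H <> (nedges G).+1 -> rule_trans a G H = 0 :> R.
Proof.
move=> GH; case: a; apply: uniform_image_eq0 => c cH; apply: GH;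
  by rewrite -cH (nedges_add_edge, nedges_subdivide).
Qed.

(** Reindexing by [pickle] reduces this to a sequence of sets; integers that code no element
    contribute the empty set. *)
Lemma negligible_bigcup_countType (d : measure_display) (T : measurableType d)
    (R : realType) (mu : {measure set T -> \bar R}) (U : countType)
    (F : U -> set T) :
  (forall u, mu.-negligible (F u)) -> mu.-negligible (\bigcup_u F u).
Proof.
move=> F0; pose F' k := oapp F set0 (unpickle k).
apply: (@negligibleS _ _ _ _ (\bigcup_k F' k)).
  by move=> x [u _ Fux]; exists (pickle u) => //; rewrite /F' pickleK.
by apply: negligible_bigcup => k; rewrite /F'; case: unpickle => [u|] /=;
  [exact: F0|exact: negligible_set0].
Qed.

Section Process.
Context (R : realType) (q r : R) (d : measure_display) (T : measurableType d)
  (P : probability T R) (A : nat -> T -> rule) (G : nat -> T -> mgraph)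
  (process : I2V_process q r P A G).

Lemma measurable_history (t : nat) (a : nat -> rule) (g : nat -> mgraph) :
  measurable (history A G t a g).
Proof.
have -> : history A G t a g =
    (\bigcap_(s in [set s | (s <= t)%N]) (G s @^-1` [set g s])) `&`
    (\bigcap_(s in [set s | (s < t)%N]) (A s @^-1` [set a s])).
  by apply/seteqP; split => w /=.
apply: measurableI; apply: bigcap_measurableType => s _.
  exact: (I2V_measurable_graph process).
exact: (I2V_measurable_rule process).
Qed.

(** The process provides measurability only for single values of [G t]; the event is a countable
    union of such fibres. *)
Lemma measurable_nedges (t m : nat) : measurable [set w | nedges (G t w) = m].
Proof.
have -> : [set w | nedges (G t w) = m] =
    \bigcup_(H : mgraph)
      (if nedges H == m then G t @^-1` [set H] else set0).
  apply/seteqP; split => w /=.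
    by move=> Gm; exists (G t w) => //; rewrite Gm eqxx.
  by move=> [H _]; case: eqP => // <- /= ->.
apply: countable_bigcupT_measurable; first exact: (@countableP mgraph).
move=> H; case: ifP => _ //; exact: (I2V_measurable_graph process).
Qed.

Lemma negligible_history (t : nat) (a : nat -> rule) (g : nat -> mgraph) :
  nedges (g t.+1) <> (nedges (g t)).+1 ->
  P.-negligible (history A G t.+1 a g).
Proof.
move=> gt; apply/negligibleP; first exact: measurable_history.
apply: etrans (I2V_step process t a g) _.
by rewrite rule_trans_eq0// mulr0 mule0.
Qed.

(** The functions [a] and [g] in [history] form uncountable types, but only their values up to
    [t.+1] matter. Finite sequences therefore index all relevant histories, and they are
    countable. *)
Lemma nedges_step_ae (t : nat) :
  P.-negligible [set w | nedges (G t.+1 w) <> (nedges (G t w)).+1].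
Proof.
(* Booleans stand for rules so that the index type is countable. The default of [nth] only fills
   positions past the end of a sequence. *)
pose code (b : bool) := if b then R2 else R3.
pose decode_rule (s : seq (mgraph * bool)) k := code (nth (triangle, true) s k).2.
pose decode_graph (s : seq (mgraph * bool)) k := (nth (triangle, true) s k).1.
(* Histories whose last step does add one edge are discarded, which makes every [F s] negligible. *)
pose F s := if nedges (decode_graph s t.+1) == (nedges (decode_graph s t)).+1
  then set0 else history A G t.+1 (decode_rule s) (decode_graph s).
apply: (@negligibleS _ _ _ _ (\bigcup_s F s)); last first.
  apply: negligible_bigcup_countType => s; rewrite /F; case: eqP => [_|].
    exact: negligible_set0.
  exact: negligible_history.
move=> w /= Gt.
(* The trajectory of [w] itself is the index. Its length is [t.+2] because the graphs at steps 0 to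
   [t.+1] are recorded. *)
pose s := mkseq (fun k => (G k w, if A k w is R2 then true else false)) t.+2.
have sG k : (k <= t.+1)%N -> decode_graph s k = G k w.
  by move=> kt; rewrite /decode_graph nth_mkseq.
exists s => //; rewrite /F !sG//; case: eqP => // _; split => k kt.
  by rewrite sG.
by rewrite /decode_rule nth_mkseq /=; [case: (A k w)|exact: leqW].
Qed.

Lemma nedges_ae (t : nat) :
  P.-negligible [set w | nedges (G t w) <> (t + 3)%N].
Proof.
elim: t => [|t IHt].
  apply: (@negligibleS _ _ _ _ (~` (G 0%N @^-1` [set triangle]))).
    by move=> w /= Gw G0; apply: Gw; rewrite G0.
  have mG := I2V_measurable_graph process 0%N triangle.
  apply/negligibleP; first exact: measurableC.
  apply: etrans (probability_setC P mG) _.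
  by rewrite (I2V_start process) subee.
(* A wrong count at step [t.+1] comes from a wrong count at step [t] or from a bad last step. *)
apply: negligibleS (negligibleU IHt (nedges_step_ae t)) => w /= Gw.
have [Gt|Gt] := eqVneq (nedges (G t w)) (t + 3)%N; last by left; exact/eqP.
by right => Gs; apply: Gw; rewrite Gs Gt.
Qed.

End Process.

Theorem lemma6p1 (R : realType) (q r : R) (q_gt0 : 0 < q) (q_lt1 : q < 1)
    (rE : r = 1 - q)
    (d : measure_display) (T : measurableType d) (P : probability T R)
    (A : nat -> T -> rule) (G : nat -> T -> mgraph)
    (process : I2V_process q r P A G) (t m : nat) :
  P [set w | nedges (G t w) = m] = (if m == (t + 3)%N then 1 else 0)%:E.
Proof.
have mG k := @measurable_nedges _ _ _ _ _ _ _ _ process t k.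
have ae := @nedges_ae _ _ _ _ _ _ _ _ process t.
case: eqP => [->|mt].
  (* The almost sure statement bounds the complement, so the probability is computed as 1 minus
     0. *)
  rewrite -[X in P X]setCK probability_setC; last exact: measurableC.
  by rewrite (measure_negligible (measurableC (mG _)) ae) sube0.
apply: measure_negligible => //.
by apply: negligibleS ae => w /= ->.
Qed.
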